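(* Let $\{\mathcal{A},G,\sigma,\alpha\}$ be a $G$-crossed system with $G\neq\{e\}$ such that the subring $\tilde{\mathcal{A}}$ is maximal commutative in $\mathcal{A}\rtimes_\alpha^\sigma G$. Then $$I\cap\tilde{\mathcal{A}}\neq\{0\}$$ for every non-zero two-sided ideal $I$ in $\mathcal{A}\rtimes_\alpha^\sigma G$.
   Context: A $G$-crossed system is a quadruple $\{\mathcal{A},G,\sigma,\alpha\}$ consisting of a unital associative ring $\mathcal{A}$ (not necessarily commutative), a group $G$ with unit $e$, a map $\sigma:G\to\mathrm{Aut}(\mathcal{A})$, $x\mapsto\sigma_x$, into the ring automorphisms of $\mathcal{A}$, and a map $\alpha:G\times G\to U(\mathcal{A})$ into the group of invertible elements of $\mathcal{A}$, such that for all $x,y,z\in G$, $a\in\mathcal{A}$: (i) $\sigma_x(\sigma_y(a))=\alpha(x,y)\,\sigma_{xy}(a)\,\alpha(x,y)^{-1}$; (ii) $\alpha(x,y)\,\alpha(xy,z)=\sigma_x(\alpha(y,z))\,\alpha(x,yz)$; (iii) $\alpha(x,e)=\alpha(e,x)=1_{\mathcal{A}}$. The crossed product $\mathcal{A}\rtimes_\alpha^\sigma G$ is the free left $\mathcal{A}$-module with basis $\{\overline{g}: g\in G\}$ (a copy of $G$), made into an associative unital ring by the biadditive multiplication determined by $(a_1\overline{x})(a_2\overline{y})=a_1\sigma_x(a_2)\,\alpha(x,y)\,\overline{xy}$. Its elements are formal sums $\sum_{g\in G}a_g\overline{g}$ with $a_g\in\mathcal{A}$, all but finitely many zero. $\tilde{\mathcal{A}}=\{a\overline{e}\mid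 a\in\mathcal{A}\}$ is the embedded copy of $\mathcal{A}$, and $\mathrm{Comm}(\tilde{\mathcal{A}})=\{b\in\mathcal{A}\rtimes_\alpha^\sigma G\mid ab=ba\ \forall a\in\tilde{\mathcal{A}}\}$. ''$\tilde{\mathcal{A}}$ is maximal commutative in $\mathcal{A}\rtimes_\alpha^\sigma G$'' means $\mathrm{Comm}(\tilde{\mathcal{A}})=\tilde{\mathcal{A}}$. *)

(* Defs.v *)
From HB Require Import structures.
From mathcomp Require Import all_boot all_algebra finmap.
From mathcomp Require Import classical_sets.
From mathcomp.multinomials Require Import monalg.

Set Implicit Arguments.
Unset Strict Implicit.
Unset Printing Implicit Defensive.

Import GRing.Theory.

Local Open Scope classical_set_scope.
Local Open Scope ring_scope.

(* Rings are [pzRingType]s, so that neither 1 != 0 nor a decidable notion of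
   invertibility is required of A; the group U(A) is therefore spelled out. *)
Record unitOf (A : pzRingType) := UnitOf {
  uval : A;
  uinv : A;
  uvalV : uval * uinv = 1;
  uVval : uinv * uval = 1
}.

Record ringAut (A : pzRingType) := RingAut {
  aut_fun :> {rmorphism A -> A};
  aut_bij : bijective aut_fun
}.

Record crossedSystem (A : pzRingType) (G : groupType) := CrossedSystem {
  csigma : G -> ringAut A;
  calpha : G -> G -> unitOf A;
  csigmaM : forall x y a,
    csigma x (csigma y a) =
    uval (calpha x y) * csigma (x * y)%g a * uinv (calpha x y);
  calphaM : forall x y z,
    uval (calpha x y) * uval (calpha (x * y)%g z) =
    csigma x (uval (calpha y z)) * uval (calpha x (y * z)%g);
  calphag1 : forall x, uval (calpha x 1%g) = 1;
  calpha1g : forall x, uval (calpha 1%g x) = 1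
}.

(* As an additive group the crossed product is that of the finitely supported
   functions G -> A: [<< a *g x >>] is the monomial a\bar{x}, and [u@_x] is the
   coefficient of u at \bar{x}. The argument S is a phantom that selects the
   multiplication. *)
Definition crossedProduct (A : pzRingType) (G : groupType)
  (S : crossedSystem A G) : Type := {malg A[G]}.

HB.instance Definition _ (A : pzRingType) (G : groupType)
  (S : crossedSystem A G) :=
  GRing.Zmodule.copy (crossedProduct S) {malg A[G]}.

Section CrossedProductRing.
Context (A : pzRingType) (G : groupType) (S : crossedSystem A G).
Local Open Scope fset_scope.

Local Notation sigma := (csigma S).
Local Notation alpha x y := (uval (calpha S x y)).
Implicit Types (u v w : {malg A[G]}) (x y z : G) (a b c : A).

Definition cpmul u v : {malg A[G]} :=
  \sum_(x <- msupp u) \sum_(y <- msupp v)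
    << u@_x * sigma x v@_y * alpha x y *g (x * y)%g >>.

Definition cpone : {malg A[G]} := << 1 *g 1%g >>.

Lemma csigma1 a : sigma 1%g a = a.
Proof.
apply: (bij_inj (aut_bij (sigma 1%g))); rewrite csigmaM mulg1.
have := uvalV (calpha S 1%g 1%g); rewrite calphag1 !mul1r => ->.
by rewrite mulr1.
Qed.

Lemma cpmulw (d1 d2 : {fset G}) u v :
  msupp u `<=` d1 -> msupp v `<=` d2 ->
  cpmul u v = \sum_(x <- d1) \sum_(y <- d2)
    << u@_x * sigma x v@_y * alpha x y *g (x * y)%g >>.
Proof.
move=> le_d1 le_d2; rewrite /cpmul (big_fset_incl _ le_d1) /=.
  apply/eq_bigr=> x _; apply/big_fset_incl => // y _ /mcoeff_outdom ->.
  by rewrite rmorph0 mulr0 mul0r monalgU0.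
move=> x _ /mcoeff_outdom ux.
by rewrite big1 // => y _; rewrite ux !mul0r monalgU0.
Qed.

Lemma cpmulUU a b x y :
  cpmul << a *g x >> << b *g y >> =
  << a * sigma x b * alpha x y *g (x * y)%g >>.
Proof. by rewrite (cpmulw msuppU_le msuppU_le) !big_seq_fset1 !mcoeffUU. Qed.

Lemma cpmulDl : left_distributive cpmul +%R.
Proof.
move=> u v w.
rewrite (cpmulw (msuppD_le _ _) (fsubset_refl (msupp w))).
rewrite (cpmulw (fsubsetUl (msupp u) (msupp v)) (fsubset_refl (msupp w))).
rewrite (cpmulw (fsubsetUr (msupp u) (msupp v)) (fsubset_refl (msupp w))).
rewrite -big_split /=; apply/eq_bigr=> x _.
rewrite -big_split /=; apply/eq_bigr=> y _.
by rewrite mcoeffD !mulrDl monalgUD.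
Qed.

Lemma cpmulDr : right_distributive cpmul +%R.
Proof.
move=> w u v.
rewrite (cpmulw (fsubset_refl (msupp w)) (msuppD_le _ _)).
rewrite (cpmulw (fsubset_refl (msupp w)) (fsubsetUl (msupp u) (msupp v))).
rewrite (cpmulw (fsubset_refl (msupp w)) (fsubsetUr (msupp u) (msupp v))).
rewrite -big_split /=; apply/eq_bigr=> x _.
rewrite -big_split /=; apply/eq_bigr=> y _.
by rewrite mcoeffD rmorphD mulrDr mulrDl monalgUD.
Qed.

Lemma cpmul0l : left_zero 0 cpmul.
Proof. by move=> u; apply: (addrI (cpmul 0 u)); rewrite -cpmulDl !addr0. Qed.

Lemma cpmul0r : right_zero 0 cpmul.
Proof. by move=> u; apply: (addrI (cpmul u 0)); rewrite -cpmulDr !addr0. Qed.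

Lemma cpmul_suml I (r : seq I) (F : I -> {malg A[G]}) u :
  cpmul (\sum_(i <- r) F i) u = \sum_(i <- r) cpmul (F i) u.
Proof.
exact: (big_morph (cpmul^~ u) (fun _ _ => cpmulDl _ _ _) (cpmul0l _)).
Qed.

Lemma cpmul_sumr I (r : seq I) (F : I -> {malg A[G]}) u :
  cpmul u (\sum_(i <- r) F i) = \sum_(i <- r) cpmul u (F i).
Proof.
exact: (big_morph (cpmul u) (fun _ _ => cpmulDr _ _ _) (cpmul0r _)).
Qed.

Lemma cpmulUUA a b c x y z :
  cpmul << a *g x >> (cpmul << b *g y >> << c *g z >>) =
  cpmul (cpmul << a *g x >> << b *g y >>) << c *g z >>.
Proof.
rewrite !cpmulUU mulgA; congr (<< _ *g _ >>).
rewrite !rmorphM csigmaM -!mulrA -calphaM.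
by rewrite (mulrA (uinv _)) uVval mul1r.
Qed.

Lemma cpmulA : associative cpmul.
Proof.
move=> u v w; rewrite (monalgE u) !cpmul_suml; apply/eq_bigr=> x _.
rewrite (monalgE v) cpmul_suml !cpmul_sumr cpmul_suml; apply/eq_bigr=> y _.
by rewrite (monalgE w) !cpmul_sumr; apply/eq_bigr=> z _; apply: cpmulUUA.
Qed.

Lemma cpmul1l : left_id cpone cpmul.
Proof.
move=> u; rewrite [in LHS](monalgE u) cpmul_sumr [RHS]monalgE.
by apply/eq_bigr=> x _; rewrite cpmulUU csigma1 calpha1g mul1g mul1r mulr1.
Qed.

Lemma cpmul1r : right_id cpone cpmul.
Proof.
move=> u; rewrite [in LHS](monalgE u) cpmul_suml [RHS]monalgE.
by apply/eq_bigr=> x _; rewrite cpmulUU rmorph1 calphag1 mulg1 !mulr1.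
Qed.

HB.instance Definition _ := GRing.Zmodule_isPzRing.Build (crossedProduct S)
  cpmulA cpmul1l cpmul1r cpmulDl cpmulDr.

Definition baseSubring : set (crossedProduct S) :=
  [set << a *g 1%g >> | a in [set: A]].

End CrossedProductRing.

Arguments baseSubring {A G} S.

Definition commutant (R : pzRingType) (B : set R) : set R :=
  [set b | forall a, B a -> a * b = b * a].

Definition maximal_commutative (R : pzRingType) (B : set R) : Prop :=
  commutant B = B.

Record two_sided_ideal (R : pzRingType) (I : set R) : Prop := TwoSidedIdeal {
  ideal0 : I 0;
  idealB : forall u v, I u -> I v -> I (u - v);
  idealMl : forall r u, I u -> I (r * u);
  idealMr : forall r u, I u -> I (u * r)
}.

(* Main.v *)
Require Import Defs.
From mathcomp Require Import all_boot all_algebra finmap.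
From mathcomp Require Import boolp classical_sets.
From mathcomp.multinomials Require Import monalg.

(** The subring of constants is commutative, because it is contained in its own
    commutant. Given a non-zero ideal, take a non-zero element of it. Right
    multiplication by a basis element moves any coefficient to position 1 up to
    a unit, without enlarging the support, so the coefficient at 1 may be
    assumed non-zero. The commutator of this element v with a constant a lies
    in the ideal and has its support inside that of v; since A is commutative,
    its coefficient at 1 vanishes, so the support is strictly smaller. Hence
    either some such commutator is non-zero and an induction on the size of the
    support applies ([ideal_meets_base]), or v commutes with every constant, and
    then maximal commutativity makes v itself a constant. *)

Import GRing.Theory.
Local Open Scope fset_scope.
Local Open Scope classical_set_scope.
Local Open Scope ring_scope.

Section CrossedProduct.
Set Implicit Arguments.
Unset Strict Implicit.
Context (A : pzRingType) (G : groupType) (S : crossedSystem A G).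

Local Notation sigma := (csigma S).
Local Notation alpha x y := (uval (calpha S x y)).
Implicit Types (u v : {malg A[G]}) (x y : G) (a b : A).

Lemma mcoeff_cpmulU u b x y :
  (cpmul S u << b *g y >>)@_(x * y)%g = u@_x * sigma x b * alpha x y.
Proof.
rewrite (cpmulw S (fsubsetU1 x _) msuppU_le) raddf_sum /=.
rewrite (big_fsetD1 x) ?fset1U1 //= big_seq_fset1 !mcoeffUU.
rewrite big_seq big1 ?addr0 // => z; rewrite in_fsetD1 => /andP[zx _].
by rewrite big_seq_fset1 mcoeffUU mcoeffU (inj_eq (mulIg y)) (negbTE zx).
Qed.

Lemma mcoeff_cpUmul u a x y :
  (cpmul S << a *g x >> u)@_(x * y)%g = a * sigma x u@_y * alpha x y.
Proof.
rewrite (cpmulw S msuppU_le (fsubsetU1 y _)) big_seq_fset1 raddf_sum /=.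
rewrite (big_fsetD1 y) ?fset1U1 //= !mcoeffUU.
rewrite big_seq big1 ?addr0 // => z; rewrite in_fsetD1 => /andP[zy _].
by rewrite mcoeffU (inj_eq (mulgI x)) (negbTE zy).
Qed.

Lemma mcoeff_cpmul_base u a x :
  (cpmul S u << a *g 1%g >>)@_x = u@_x * sigma x a.
Proof. by rewrite -{1}[x]mulg1 mcoeff_cpmulU calphag1 mulr1. Qed.

Lemma mcoeff_cpbase_mul u a x :
  (cpmul S << a *g 1%g >> u)@_x = a * u@_x.
Proof. by rewrite -{1}[x]mul1g mcoeff_cpUmul calpha1g csigma1 mulr1. Qed.

Lemma card_msupp_cpmulU u b y :
  (#|` msupp (cpmul S u << b *g y >>)| <= #|` msupp u|)%N.
Proof.
have <- : #|` [fset (x * y)%g | x in msupp u]| = #|` msupp u|.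
  by rewrite card_imfset //; apply: mulIg.
apply/fsubset_leq_card; apply/fsubsetP => z; rewrite -mcoeff_neq0 -[z](mulgVK y).
rewrite mcoeff_cpmulU => nz; apply/imfsetP; exists (z * y^-1)%g => //=.
by rewrite -mcoeff_neq0; apply: contraNneq nz => ->; rewrite !mul0r.
Qed.

(** Multiplying by the basis element at [x^-1] puts at 1 the coefficient
    [u@_x] times a unit. *)
Lemma mcoeff1_cpmulV_neq0 u x : u@_x != 0 ->
  (cpmul S u << 1 *g x^-1%g >>)@_1%g != 0.
Proof.
rewrite -(mulgV x) mcoeff_cpmulU rmorph1 mulr1; apply: contraNneq => ux0.
by rewrite -[u@_x]mulr1 -(uvalV (calpha S x x^-1%g)) mulrA ux0 mul0r.
Qed.

(** A constant lies in the commutant of the constants; comparing coefficients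
    at 1 brings the relation down to A. *)
Lemma maximal_commutative_comm :
  maximal_commutative (baseSubring S) -> commutative (@GRing.mul A).
Proof.
move=> hmax a b.
have : commutant (baseSubring S) << b *g 1%g >> by rewrite hmax; exists b.
move/(_ << a *g 1%g >>) => /(_ (ex_intro2 _ _ a I erefl)).
move/(congr1 (fun u : {malg A[G]} => u@_1%g)).
by rewrite !mcoeff_cpbase_mul !mcoeffUU.
Qed.

(** The coefficient of the commutator at [x] is [a * v@_x - v@_x * sigma x a]:
    it vanishes with [v@_x], and also at [x = 1], where [sigma] is the identity
    and A is commutative. *)
Lemma card_msupp_commutator v a : commutative (@GRing.mul A) -> v@_1%g != 0 ->
  (#|` msupp (cpmul S << a *g 1%g >> v - cpmul S v << a *g 1%g >>)|
     < #|` msupp v|)%N.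
Proof.
move=> mulC v1; apply: fproper_ltn_card.
apply: (@fsub_proper_trans _ (msupp v `\ 1%g)%fset).
  apply/fsubsetP => x; rewrite in_fsetD1 -!mcoeff_neq0 mcoeffB.
  rewrite mcoeff_cpbase_mul mcoeff_cpmul_base => nz.
  apply/andP; split; apply: contraNneq nz => ->.
    by rewrite csigma1 mulC subrr.
  by rewrite mulr0 mul0r subrr.
by apply: fproperD1; rewrite -mcoeff_neq0.
Qed.

(** Strong induction on the size of the support of [u]: normalise [u] to have a
    non-zero coefficient at 1, then replace it by a non-zero commutator with a
    constant for as long as there is one. *)
Lemma ideal_meets_base (I : set (crossedProduct S)) :
    maximal_commutative (baseSubring S) -> two_sided_ideal I ->
  forall u : crossedProduct S, I u -> u <> 0 ->
  exists v : crossedProduct S, [/\ I v, baseSubring S v & v <> 0].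
Proof.
move=> hmax hI u; have mulC := maximal_commutative_comm hmax.
have [n] := ubnP #|` msupp (u : {malg A[G]})|.
elim: n u => // n IHn u le_u_n Iu /eqP u0.
have [x ux] : exists x, (u : {malg A[G]})@_x != 0.
  apply/not_existsP => uE; case/eqP: u0; apply/malgP => x.
  by rewrite mcoeff0; apply/eqP/negPn/negP/uE.
pose v := u * (<< 1 *g x^-1%g >> : crossedProduct S).
have Iv : I v by exact: (Defs.idealMr hI).
have v1 : (v : {malg A[G]})@_1%g != 0 by apply: mcoeff1_cpmulV_neq0.
have [vC|] := pselect (commutant (baseSubring S) v).
  exists v; split=> //; first by rewrite -hmax.
  by move=> v0; rewrite v0 mcoeff0 eqxx in v1.
move/existsNP => [_ /not_implyP[[a _ <-] neq_va]].
apply: (IHn _ _ (Defs.idealB hI (Defs.idealMl hI _ Iv) (Defs.idealMr hI _ Iv))); last first.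
  by move/subr0_eq/neq_va.
apply: leq_trans (card_msupp_commutator a mulC v1) _.
exact: leq_trans (card_msupp_cpmulU _ _ _) le_u_n.
Qed.

End CrossedProduct.

Theorem corollary5p2 (A : pzRingType) (G : groupType) (S : crossedSystem A G)
  (hG : [set: G] <> [set 1%g])
  (hmax : maximal_commutative (baseSubring S))
  (I : set (crossedProduct S))
  (hI : two_sided_ideal I)
  (hI0 : I <> [set 0]) :
  I `&` baseSubring S <> [set 0].
Proof.
move=> meet0; apply: hI0; apply/seteqP; split=> [u Iu|_ ->]; last exact: Defs.ideal0 hI.
apply: contrapT => u0; have [v [Iv Bv v0]] := ideal_meets_base hmax hI Iu u0.
by apply: v0; rewrite -[v = 0]/([set 0] v) -meet0.
Qed.
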